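(* Let $\mathcal{A}$ be a tensor category over $k$ and let $\mathcal{C}$ be a two-sided Serre tensor-ideal of $\mathcal{A}$. Then $\mathcal{C}$ is trivial, i.e. either $\mathcal{C}=0$ or $\mathcal{C}=\mathcal{A}$.
   Context: $k$ is an algebraically closed field. A $k$-linear abelian category is locally finite if all its Hom spaces are finite dimensional over $k$ and every object has finite length. A multitensor category over $k$ is a locally finite $k$-linear abelian rigid monoidal category with bilinear tensor product (which is then automatically biexact). A tensor category is a multitensor category $\mathcal{A}$ with $\mathrm{End}_{\mathcal{A}}(1)=k$ that is indecomposable, i.e. not equivalent to a direct sum of nonzero multitensor categories. A Serre subcategory of an abelian category is a full additive subcategory closed under subobjects, quotients and extensions. A two-sided Serre tensor-ideal of an abelian monoidal category $\mathcal{A}$ is a Serre subcategory $\mathcal{C}$ such that $X\otimes Y\in\mathcal{C}$ and $Y\otimes X\in\mathcal{C}$ for all $X\in\mathcal{A}$, $Y\in\mathcal{C}$. $\mathcal{C}=0$ means that $\mathcal{C}$ contains only zero objects. *)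

(* Defs.v *)
From HB Require Import structures.
From mathcomp Require Import all_boot all_algebra.

Set Implicit Arguments.
Unset Strict Implicit.
Unset Printing Implicit Defensive.

Import GRing.Theory.
Local Open Scope ring_scope.

Declare Scope cat_scope.
Delimit Scope cat_scope with cat.
Local Open Scope cat_scope.

Reserved Notation "g \oc f" (at level 40, left associativity).
Reserved Notation "X \ox Y" (at level 35, right associativity).
Reserved Notation "f \om g" (at level 35, right associativity).

Section LinearCategories.
Variable k : fieldType.

Record linCat := LinCat {
  obj :> Type;
  mor : obj -> obj -> lmodType k;
  idm : forall X, mor X X;
  compm : forall X Y Z, mor Y Z -> mor X Y -> mor X Z;
  compmA : forall X Y Z W (h : mor Z W) (g : mor Y Z) (f : mor X Y),
    compm h (compm g f) = compm (compm h g) f;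
  comp1m : forall X Y (f : mor X Y), compm (idm Y) f = f;
  compm1 : forall X Y (f : mor X Y), compm f (idm X) = f;
  compm_linear_r : forall X Y Z (g : mor Y Z),
    linear (fun f : mor X Y => compm g f);
  compm_linear_l : forall X Y Z (f : mor X Y),
    linear (fun g : mor Y Z => compm g f)
}.

End LinearCategories.

Arguments mor {k C} : rename.
Arguments idm {k C} X : rename.
Arguments compm {k C X Y Z} g f : rename.

Notation "g \oc f" := (compm g f) : cat_scope.

Section LinCatNotions.
Variables (k : fieldType) (C : linCat k).
Implicit Types X Y Z W : C.

Record iso X Y := Iso {
  fwd : mor X Y;
  bwd : mor Y X;
  fwdK : bwd \oc fwd = idm X;
  bwdK : fwd \oc bwd = idm Y
}.

Definition is_mono X Y (f : mor X Y) : Prop :=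
  forall W (u v : mor W X), f \oc u = f \oc v -> u = v.

Definition is_epi X Y (f : mor X Y) : Prop :=
  forall W (u v : mor Y W), u \oc f = v \oc f -> u = v.

Definition is_iso X Y (f : mor X Y) : Prop :=
  exists g : mor Y X, g \oc f = idm X /\ f \oc g = idm Y.

(* Both initial and terminal; existence of arrows is free, since Hom spaces
   contain 0. *)
Definition is_zero X : Prop :=
  forall Y, (forall f g : mor X Y, f = g) /\ (forall f g : mor Y X, f = g).

Record is_biproduct X Y P (i1 : mor X P) (i2 : mor Y P)
    (p1 : mor P X) (p2 : mor P Y) : Prop := IsBiproduct {
  biprod_p1i1 : p1 \oc i1 = idm X;
  biprod_p2i2 : p2 \oc i2 = idm Y;
  biprod_p1i2 : p1 \oc i2 = 0;
  biprod_p2i1 : p2 \oc i1 = 0;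
  biprod_id : i1 \oc p1 + i2 \oc p2 = idm P
}.

Definition is_kernel X Y K (f : mor X Y) (i : mor K X) : Prop :=
  f \oc i = 0 /\
  forall W (u : mor W X), f \oc u = 0 -> exists! v : mor W K, i \oc v = u.

Definition is_cokernel X Y Q (f : mor X Y) (p : mor Y Q) : Prop :=
  p \oc f = 0 /\
  forall W (u : mor Y W), u \oc f = 0 -> exists! v : mor Q W, v \oc p = u.

Definition short_exact X Y Z (f : mor X Y) (g : mor Y Z) : Prop :=
  is_kernel g f /\ is_cokernel f g.

Definition is_simple X : Prop :=
  ~ is_zero X /\
  forall Y (f : mor Y X), is_mono f -> is_zero Y \/ is_iso f.

(* Existence of a composition series: Y has a subobject X, itself with a
   composition series, such that Y / X is simple. *)
Inductive finite_length : C -> Prop :=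
| FiniteLength0 X : is_zero X -> finite_length X
| FiniteLengthS X Y S (f : mor X Y) (g : mor Y S) :
    finite_length X -> is_simple S -> short_exact f g -> finite_length Y.

End LinCatNotions.

Record is_abelian (k : fieldType) (C : linCat k) : Prop := IsAbelian {
  abelian_zero : exists Z : C, is_zero Z;
  abelian_biproduct : forall X Y : C,
    exists P (i1 : mor X P) (i2 : mor Y P) (p1 : mor P X) (p2 : mor P Y),
      is_biproduct i1 i2 p1 p2;
  abelian_kernel : forall (X Y : C) (f : mor X Y),
    exists K (i : mor K X), is_kernel f i;
  abelian_cokernel : forall (X Y : C) (f : mor X Y),
    exists Q (p : mor Y Q), is_cokernel f p;
  abelian_mono : forall (X Y : C) (f : mor X Y), is_mono f ->
    exists Z (g : mor Y Z), is_kernel g f;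
  abelian_epi : forall (X Y : C) (f : mor X Y), is_epi f ->
    exists Z (g : mor Z X), is_cokernel g f
}.

Definition findim (k : fieldType) (V : lmodType k) : Prop :=
  exists n : nat, inhabited (Vector.axiom n V).

Definition locally_finite (k : fieldType) (C : linCat k) : Prop :=
  (forall X Y : C, findim (mor X Y)) /\ (forall X : C, finite_length X).

Record linFunctor (k : fieldType) (C D : linCat k) := LinFunctor {
  fobj :> C -> D;
  fmap : forall X Y : C, mor X Y -> mor (fobj X) (fobj Y);
  fmap_linear : forall X Y : C, linear (@fmap X Y);
  fmap1 : forall X : C, fmap (idm X) = idm (fobj X);
  fmapM : forall (X Y Z : C) (g : mor Y Z) (f : mor X Y),
    fmap (g \oc f) = fmap g \oc fmap f
}.

Arguments fmap {k C D} F {X Y} f : rename.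

Definition is_equivalence (k : fieldType) (C D : linCat k)
    (F : linFunctor C D) : Prop :=
  exists (G : linFunctor D C)
    (eta : forall X : C, iso X (G (F X)))
    (eps : forall Y : D, iso (F (G Y)) Y),
    (forall (X X' : C) (f : mor X X'),
       fwd (eta X') \oc f = fmap G (fmap F f) \oc fwd (eta X)) /\
    (forall (Y Y' : D) (g : mor Y Y'),
       g \oc fwd (eps Y) = fwd (eps Y') \oc fmap F (fmap G g)).

(* Bilinearity of the tensor product on morphisms is not part of this record:
   it is a clause of [is_multitensor]. *)
Record monCat (k : fieldType) := MonCat {
  lincat :> linCat k;
  tens : lincat -> lincat -> lincat;
  tensm : forall X X' Y Y' : lincat,
    mor X X' -> mor Y Y' -> mor (tens X Y) (tens X' Y');
  tensm1 : forall X Y : lincat, tensm (idm X) (idm Y) = idm (tens X Y);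
  tensmM : forall (X X' X'' Y Y' Y'' : lincat) (f' : mor X' X'')
      (f : mor X X') (g' : mor Y' Y'') (g : mor Y Y'),
    tensm (f' \oc f) (g' \oc g) = tensm f' g' \oc tensm f g;
  unit1 : lincat;
  assoc : forall X Y Z : lincat,
    iso (tens (tens X Y) Z) (tens X (tens Y Z));
  lunit : forall X : lincat, iso (tens unit1 X) X;
  runit : forall X : lincat, iso (tens X unit1) X;
  assoc_nat : forall (X X' Y Y' Z Z' : lincat)
      (f : mor X X') (g : mor Y Y') (h : mor Z Z'),
    fwd (assoc X' Y' Z') \oc tensm (tensm f g) h =
    tensm f (tensm g h) \oc fwd (assoc X Y Z);
  lunit_nat : forall (X X' : lincat) (f : mor X X'),
    fwd (lunit X') \oc tensm (idm unit1) f = f \oc fwd (lunit X);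
  runit_nat : forall (X X' : lincat) (f : mor X X'),
    fwd (runit X') \oc tensm f (idm unit1) = f \oc fwd (runit X);
  pentagon : forall W X Y Z : lincat,
    tensm (idm W) (fwd (assoc X Y Z)) \oc fwd (assoc W (tens X Y) Z)
      \oc tensm (fwd (assoc W X Y)) (idm Z) =
    fwd (assoc W X (tens Y Z)) \oc fwd (assoc (tens W X) Y Z);
  triangle : forall X Y : lincat,
    tensm (idm X) (fwd (lunit Y)) \oc fwd (assoc X unit1 Y) =
    tensm (fwd (runit X)) (idm Y)
}.

Arguments tens {k A} X Y : rename.
Arguments tensm {k A X X' Y Y'} f g : rename.
Arguments unit1 {k} A : rename.
Arguments assoc {k A} X Y Z : rename.
Arguments lunit {k A} X : rename.
Arguments runit {k A} X : rename.

Notation "X \ox Y" := (tens X Y) : cat_scope.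
Notation "f \om g" := (tensm f g) : cat_scope.

Section MultitensorCategories.
Variable k : fieldType.

Definition tens_bilinear (A : monCat k) : Prop :=
  (forall (X X' Y Y' : A) (g : mor Y Y'),
     linear (fun f : mor X X' => f \om g)) /\
  (forall (X X' Y Y' : A) (f : mor X X'),
     linear (fun g : mor Y Y' => f \om g)).

(* The zigzag identities exhibiting D as a left dual of X, equivalently X as a
   right dual of D. *)
Definition is_duality (A : monCat k) (D X : A)
    (ev : mor (D \ox X) (unit1 A)) (coev : mor (unit1 A) (X \ox D)) : Prop :=
  fwd (runit X) \oc (idm X \om ev) \oc fwd (assoc X D X)
    \oc (coev \om idm X) \oc bwd (lunit X) = idm X /\
  fwd (lunit D) \oc (ev \om idm D) \oc bwd (assoc D X D)
    \oc (idm D \om coev) \oc bwd (runit D) = idm D.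

Definition is_rigid (A : monCat k) : Prop :=
  forall X : A,
    (exists D ev coev, @is_duality A D X ev coev) /\
    (exists D ev coev, @is_duality A X D ev coev).

Record is_multitensor (A : monCat k) : Prop := IsMultitensor {
  multitensor_abelian : is_abelian A;
  multitensor_locally_finite : locally_finite A;
  multitensor_bilinear : tens_bilinear A;
  multitensor_rigid : is_rigid A
}.

Definition is_nonzero (C : linCat k) : Prop := exists X : C, ~ is_zero X.

Record is_monoidal (A B : monCat k) (F : linFunctor A B)
    (J : forall X Y : A, iso (F X \ox F Y) (F (X \ox Y)))
    (phi : iso (unit1 B) (F (unit1 A))) : Prop := IsMonoidal {
  monoidal_nat : forall (X X' Y Y' : A) (f : mor X X') (g : mor Y Y'),
    fwd (J X' Y') \oc (fmap F f \om fmap F g) =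
    fmap F (f \om g) \oc fwd (J X Y);
  monoidal_assoc : forall X Y Z : A,
    fmap F (fwd (assoc X Y Z)) \oc fwd (J (X \ox Y) Z)
      \oc (fwd (J X Y) \om idm (F Z)) =
    fwd (J X (Y \ox Z)) \oc (idm (F X) \om fwd (J Y Z))
      \oc fwd (assoc (F X) (F Y) (F Z));
  monoidal_lunit : forall X : A,
    fmap F (fwd (lunit X)) \oc fwd (J (unit1 A) X)
      \oc (fwd phi \om idm (F X)) = fwd (lunit (F X));
  monoidal_runit : forall X : A,
    fmap F (fwd (runit X)) \oc fwd (J X (unit1 A))
      \oc (idm (F X) \om fwd phi) = fwd (runit (F X))
}.

Definition mon_equivalent (A B : monCat k) : Prop :=
  exists (F : linFunctor A B)
    (J : forall X Y : A, iso (F X \ox F Y) (F (X \ox Y)))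
    (phi : iso (unit1 B) (F (unit1 A))),
    is_monoidal J phi /\ is_equivalence F.

End MultitensorCategories.

Section DirectSum.
Variable k : fieldType.

Section LinCatSum.
Variables C D : linCat k.

Definition sum_mor (X Y : C * D) : lmodType k :=
  (mor X.1 Y.1 * mor X.2 Y.2)%type.

Definition sum_idm (X : C * D) : sum_mor X X := (idm X.1, idm X.2).

Definition sum_comp (X Y Z : C * D) (g : sum_mor Y Z) (f : sum_mor X Y) :
  sum_mor X Z := (g.1 \oc f.1, g.2 \oc f.2).

Fact sum_compA X Y Z W (h : sum_mor Z W) (g : sum_mor Y Z) (f : sum_mor X Y) :
  sum_comp h (sum_comp g f) = sum_comp (sum_comp h g) f.
Proof. by rewrite /sum_comp /= !compmA. Qed.

Fact sum_comp1m X Y (f : sum_mor X Y) : sum_comp (sum_idm Y) f = f.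
Proof. by case: f => f1 f2; rewrite /sum_comp /= !comp1m. Qed.

Fact sum_compm1 X Y (f : sum_mor X Y) : sum_comp f (sum_idm X) = f.
Proof. by case: f => f1 f2; rewrite /sum_comp /= !compm1. Qed.

Fact sum_comp_linear_r X Y Z (g : sum_mor Y Z) :
  linear (fun f : sum_mor X Y => sum_comp g f).
Proof. by move=> a u v; congr pair; apply: compm_linear_r. Qed.

Fact sum_comp_linear_l X Y Z (f : sum_mor X Y) :
  linear (fun g : sum_mor Y Z => sum_comp g f).
Proof.
by move=> a u v; congr pair; [exact: (compm_linear_l f.1 a u.1 v.1)
                             |exact: (compm_linear_l f.2 a u.2 v.2)].
Qed.

Definition linCat_sum : linCat k :=
  LinCat sum_compA sum_comp1m sum_compm1 sum_comp_linear_r sum_comp_linear_l.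

Definition sum_iso (X Y : linCat_sum) (a : iso X.1 Y.1) (b : iso X.2 Y.2) :
  iso X Y.
Proof.
apply: (@Iso _ linCat_sum X Y (fwd a, fwd b) (bwd a, bwd b)).
- by congr pair; apply: fwdK.
- by congr pair; apply: bwdK.
Defined.

End LinCatSum.

Variables A B : monCat k.
Let S : linCat k := linCat_sum A B.

Definition monCat_sum : monCat k.
Proof.
apply: (@MonCat k S
  (fun X Y => (X.1 \ox Y.1, X.2 \ox Y.2))
  (fun X X' Y Y' f g => (f.1 \om g.1, f.2 \om g.2))
  _ _
  (unit1 A, unit1 B)
  (fun X Y Z => sum_iso (X := (_, _)) (Y := (_, _))
                  (assoc X.1 Y.1 Z.1) (assoc X.2 Y.2 Z.2))
  (fun X => sum_iso (X := (_, _)) (Y := X) (lunit X.1) (lunit X.2))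
  (fun X => sum_iso (X := (_, _)) (Y := X) (runit X.1) (runit X.2))).
- by move=> X Y; congr pair; apply: tensm1.
- by move=> *; congr pair; apply: tensmM.
- by move=> *; congr pair; apply: assoc_nat.
- by move=> *; congr pair; apply: lunit_nat.
- by move=> *; congr pair; apply: runit_nat.
- by move=> *; congr pair; apply: pentagon.
- by move=> *; congr pair; apply: triangle.
Defined.

End DirectSum.

(* Two summands suffice: a direct sum of n >= 2 nonzero multitensor categories
   is the direct sum of the first one and of the sum of the others. *)
Definition is_indecomposable (k : fieldType) (A : monCat k) : Prop :=
  ~ exists A1 A2 : monCat k,
      [/\ is_multitensor A1, is_nonzero A1, is_multitensor A2, is_nonzero A2
        & mon_equivalent A (monCat_sum A1 A2)].

Record is_tensor_category (k : fieldType) (A : monCat k) : Prop :=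
  IsTensorCategory {
    tensor_multitensor : is_multitensor A;
    tensor_End_unit :
      bijective (fun a : k => a *: idm (unit1 A) : mor (unit1 A) (unit1 A));
    tensor_indecomposable : is_indecomposable A
  }.

(* Full subcategories are given by the predicate selecting their objects. *)
Record is_serre (k : fieldType) (C : linCat k) (P : C -> Prop) : Prop :=
  IsSerre {
    serre_zero : exists2 Z : C, is_zero Z & P Z;
    serre_biproduct : forall (X Y Q : C) (i1 : mor X Q) (i2 : mor Y Q)
        (p1 : mor Q X) (p2 : mor Q Y),
      is_biproduct i1 i2 p1 p2 -> P X -> P Y -> P Q;
    serre_sub : forall (X Y : C) (f : mor X Y), is_mono f -> P Y -> P X;
    serre_quot : forall (X Y : C) (f : mor X Y), is_epi f -> P X -> P Y;
    serre_ext : forall (X Y Z : C) (f : mor X Y) (g : mor Y Z),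
      short_exact f g -> P X -> P Z -> P Y
  }.

Definition is_serre_tensor_ideal (k : fieldType) (A : monCat k)
    (P : A -> Prop) : Prop :=
  is_serre P /\ forall X Y : A, P Y -> P (X \ox Y) /\ P (Y \ox X).

(* Main.v *)
Require Import Defs.
From mathcomp Require Import all_boot all_algebra.
From Stdlib Require Import Classical.

(** The point is that the unit object 1 is simple ([unit_simple]). Granting
    this, a nonzero X in the ideal has a nonzero coevaluation 1 -> X (x) D,
    which is a monomorphism because its source is simple; so 1 lies in the
    ideal, being a subobject of X (x) D, and then so does every Y = Y (x) 1.

    For the simplicity of 1, finite length gives a simple subobject i : J -> 1,
    and it suffices to show that i is an isomorphism. Let D be the dual of J
    with coev : 1 -> J (x) D. The transpose t : 1 -> D of i is an epimorphism
    ([dual_inclusion_epi]): under the duality, cancelling t becomes cancelling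
    i (x) W, and i (x) W is mono because tensoring with W has an adjoint. For
    the same reason J (x) t is epi, which gives an epimorphism
    q : J -> J (x) D. It is nonzero since coev is, hence mono by simplicity of
    J; so coev factors as q o s with a nonzero s : 1 -> J. Now i o s is
    a nonzero endomorphism of 1, hence an invertible scalar as End(1) = k, and
    the monomorphism i is split epi.

    Exactness of the tensor product enters only through [rwhisk_dual_mono] and
    [lwhisk_dual_epi]. Both transpose a morphism along a duality and transpose
    it back; the double transpose differs from the original by whiskered
    snakes, which are invertible, and checking that it vanishes only with the
    original needs the pentagon but no coherence of the unit isomorphisms
    with tensor products. *)

Set Implicit Arguments.
Unset Strict Implicit.
Unset Printing Implicit Defensive.

Import GRing.Theory.
Local Open Scope ring_scope.
Local Open Scope cat_scope.

(** * Linear maps and linear categories *)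

Section Linear.
Variables (k : fieldType) (U V : lmodType k) (f : U -> V).
Hypothesis f_lin : linear f.

Lemma linear_zero : f 0 = 0.
Proof. by have := f_lin (-1) 0 0; rewrite !scaleN1r oppr0 addNr addr0. Qed.

Lemma linear_sub u v : f (u - v) = f u - f v.
Proof. by have := f_lin (-1) v u; rewrite !scaleN1r ![- _ + _]addrC. Qed.

Lemma linear_scale c u : f (c *: u) = c *: f u.
Proof. by have := f_lin c u 0; rewrite linear_zero !addr0. Qed.
End Linear.

Section Cat.
Variables (k : fieldType) (C : linCat k).
Implicit Types X Y Z W K : C.

Lemma compm0 X Y Z (g : mor Y Z) : g \oc (0 : mor X Y) = 0.
Proof. exact: (linear_zero (compm_linear_r g)). Qed.

Lemma comp0m X Y Z (f : mor X Y) : (0 : mor Y Z) \oc f = 0.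
Proof. exact: (linear_zero (compm_linear_l f)). Qed.

Lemma compmB X Y Z (g : mor Y Z) (u v : mor X Y) :
  g \oc (u - v) = g \oc u - g \oc v.
Proof. exact: (linear_sub (compm_linear_r g)). Qed.

Lemma compBm X Y Z (f : mor X Y) (u v : mor Y Z) :
  (u - v) \oc f = u \oc f - v \oc f.
Proof. exact: (linear_sub (compm_linear_l f)). Qed.

Lemma compmZ X Y Z (g : mor Y Z) c (u : mor X Y) :
  g \oc (c *: u) = c *: (g \oc u).
Proof. exact: (linear_scale (compm_linear_r g)). Qed.

Lemma mono_of_cancel0 X Y (f : mor X Y) :
  (forall W (u : mor W X), f \oc u = 0 -> u = 0) -> is_mono f.
Proof.
move=> f0 W u v fuv; apply/eqP; rewrite -subr_eq0; apply/eqP/f0.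
by rewrite compmB fuv subrr.
Qed.

Lemma epi_of_cancel0 X Y (f : mor X Y) :
  (forall W (u : mor Y W), u \oc f = 0 -> u = 0) -> is_epi f.
Proof.
move=> f0 W u v fuv; apply/eqP; rewrite -subr_eq0; apply/eqP/f0.
by rewrite compBm fuv subrr.
Qed.

Lemma mono_cancel0 X Y (f : mor X Y) W (u : mor W X) :
  is_mono f -> f \oc u = 0 -> u = 0.
Proof. by move=> fm fu0; apply: fm; rewrite fu0 compm0. Qed.

Lemma epi_cancel0 X Y (f : mor X Y) W (u : mor Y W) :
  is_epi f -> u \oc f = 0 -> u = 0.
Proof. by move=> fe fu0; apply: fe; rewrite fu0 comp0m. Qed.

Lemma split_mono X Y (f : mor X Y) (g : mor Y X) :
  g \oc f = idm X -> is_mono f.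
Proof.
by move=> gf W u v fuv; rewrite -(comp1m u) -(comp1m v) -gf -!compmA fuv.
Qed.

Lemma split_epi X Y (f : mor X Y) (g : mor Y X) :
  f \oc g = idm Y -> is_epi f.
Proof.
by move=> fg W u v fuv; rewrite -(compm1 u) -(compm1 v) -fg !compmA fuv.
Qed.

Lemma mono_comp X Y Z (g : mor Y Z) (f : mor X Y) :
  is_mono g -> is_mono f -> is_mono (g \oc f).
Proof. by move=> gm fm W u v; rewrite -!compmA => /gm/fm. Qed.

Lemma epi_comp X Y Z (g : mor Y Z) (f : mor X Y) :
  is_epi g -> is_epi f -> is_epi (g \oc f).
Proof. by move=> ge fe W u v; rewrite !compmA => /fe/ge. Qed.

Lemma is_zeroE X : is_zero X <-> idm X = 0.
Proof.
split=> [/(_ X) [z _]|id0 Y]; first exact: z.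
split=> f g.
  by rewrite -(compm1 f) -(compm1 g) id0 !compm0.
by rewrite -(comp1m f) -(comp1m g) id0 !comp0m.
Qed.

Lemma kernel_mono X Y K (f : mor X Y) (i : mor K X) :
  is_kernel f i -> is_mono i.
Proof.
move=> [fi0 fK] W u v iuv.
have [|w [_ uniq_w]] := fK W (i \oc u); first by rewrite compmA fi0 comp0m.
by rewrite -(uniq_w u) // -(uniq_w v).
Qed.

(** Schur: the kernel of f is a subobject of X, hence zero, or all of X, in
    which case f = 0. *)
Lemma simple_mono X Y (f : mor X Y) :
  is_abelian C -> is_simple X -> f <> 0 -> is_mono f.
Proof.
move=> abC [_ subX] f_neq0.
have [K [i ker_f]] := abelian_kernel abC f.
have [fi0 fK] := ker_f.
case: (subX _ _ (kernel_mono ker_f)) => [K0|[g [_ ig]]].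
  apply: mono_of_cancel0 => W u /fK [w [<- _]].
  by rewrite (proj2 (K0 W) w 0) compm0.
by case: f_neq0; rewrite -(compm1 f) -ig compmA fi0 comp0m.
Qed.

(** The bottom term of a composition series is simple: either the smaller
    object X of the last step is nonzero and contains one already, or X = 0 and
    then Y embeds in the simple quotient S. *)
Lemma finite_length_simple_sub X :
  finite_length X -> ~ is_zero X ->
  exists S (i : mor S X), is_simple S /\ is_mono i.
Proof.
elim=> {X} [X X0 /(_ X0) []|X Y S f g _ IH S_simple [ker_g _] Y_neq0].
have f_mono := kernel_mono ker_g.
case: (classic (is_zero X)) => [X0|/IH [T [i [T_simple i_mono]]]]; last first.
  by exists T, (f \oc i); split=> //; apply: mono_comp.
(* Since X = 0, the map g : Y -> S is mono, and Y inherits simplicity from S. *)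
exists Y, (idm Y); split; last by apply: split_mono (comp1m _).
split=> // Z h h_mono.
have g_mono : is_mono g.
  apply: mono_of_cancel0 => W u /(proj2 ker_g) [w [<- _]].
  by rewrite (proj2 (X0 W) w 0) compm0.
case: (proj2 S_simple _ _ (mono_comp g_mono h_mono)) => [|[r [rgh ghr]]].
  by left.
right; exists (r \oc g); split; first by rewrite -compmA.
by apply: g_mono; rewrite !compmA ghr comp1m compm1.
Qed.

End Cat.

(** * Monoidal calculus *)

Section Mon.
Variables (k : fieldType) (A : monCat k).
Implicit Types X Y Z W D : A.

Lemma lwhiskM W X Y Z (g : mor Y Z) (f : mor X Y) :
  (idm W \om g) \oc (idm W \om f) = idm W \om (g \oc f).
Proof. by rewrite -tensmM comp1m. Qed.

Lemma rwhiskM W X Y Z (g : mor Y Z) (f : mor X Y) :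
  (g \om idm W) \oc (f \om idm W) = (g \oc f) \om idm W.
Proof. by rewrite -tensmM comp1m. Qed.

Lemma whiskC X X' Y Y' (f : mor X X') (g : mor Y Y') :
  (f \om idm Y') \oc (idm X \om g) = (idm X' \om g) \oc (f \om idm Y).
Proof. by rewrite -!tensmM !comp1m !compm1. Qed.

Lemma assoc_bwd_nat X X' Y Y' Z Z' (f : mor X X') (g : mor Y Y')
    (h : mor Z Z') :
  bwd (assoc X' Y' Z') \oc (f \om (g \om h)) =
  ((f \om g) \om h) \oc bwd (assoc X Y Z).
Proof.
rewrite -[LHS]compm1 -(bwdK (assoc X Y Z)) compmA -(compmA _ _ (fwd _)).
by rewrite -assoc_nat !compmA fwdK comp1m.
Qed.

(** The pentagon, solved for the two composites of associators that appear when
    a morphism is transposed twice, on the right here and on the left below. *)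
Lemma pentagon_bwd W X Y Z :
  (fwd (assoc W X Y) \om idm Z) \oc bwd (assoc (W \ox X) Y Z) =
  bwd (assoc W (X \ox Y) Z) \oc (idm W \om bwd (assoc X Y Z))
    \oc fwd (assoc W X (Y \ox Z)).
Proof.
rewrite -[RHS]compm1 -(bwdK (assoc (W \ox X) Y Z)) !compmA.
rewrite -(compmA _ (fwd _) (fwd _)) -pentagon !compmA.
rewrite -(compmA _ (idm W \om _) (idm W \om _)) lwhiskM fwdK tensm1 compm1.
by rewrite fwdK comp1m.
Qed.

Lemma pentagon_bwd_r W X Y Z :
  bwd (assoc W X (Y \ox Z)) \oc (idm W \om fwd (assoc X Y Z)) =
  fwd (assoc (W \ox X) Y Z) \oc (bwd (assoc W X Y) \om idm Z)
    \oc bwd (assoc W (X \ox Y) Z).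
Proof.
rewrite -[fwd _ \oc _]comp1m -(fwdK (assoc W X (Y \ox Z))).
rewrite -!compmA (compmA (fwd _) (fwd _)) -pentagon !compmA.
rewrite -(compmA _ (_ \om idm Z) (_ \om idm Z)) rwhiskM bwdK tensm1 compm1.
by rewrite -!compmA bwdK compm1.
Qed.

Hypothesis bilA : tens_bilinear A.

Lemma tens0m X X' Y Y' (g : mor Y Y') : (0 : mor X X') \om g = 0.
Proof. exact: (linear_zero (proj1 bilA X X' Y Y' g)). Qed.

Lemma tensm0 X X' Y Y' (f : mor X X') : f \om (0 : mor Y Y') = 0.
Proof. exact: (linear_zero (proj2 bilA X X' Y Y' f)). Qed.

Lemma rwhisk_unit_inj0 X Y (f : mor X Y) :
  f \om idm (unit1 A) = 0 -> f = 0.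
Proof.
move=> f0; rewrite -(compm1 f) -(bwdK (runit X)) compmA -runit_nat f0.
by rewrite compm0 comp0m.
Qed.

Lemma lwhisk_unit_inj0 X Y (f : mor X Y) :
  idm (unit1 A) \om f = 0 -> f = 0.
Proof.
move=> f0; rewrite -(compm1 f) -(bwdK (lunit X)) compmA -lunit_nat f0.
by rewrite compm0 comp0m.
Qed.

(** * Dualities *)

Section Duality.
Variables (D X : A).
Variables (ev : mor (D \ox X) (unit1 A)) (coev : mor (unit1 A) (X \ox D)).
Hypothesis dual : is_duality ev coev.

(** By the zigzag identity the identity of X factors through coev tensored
    with X. *)
Lemma coev_neq0 : ~ is_zero X -> coev <> 0.
Proof.
move=> X_neq0 coev0; apply: X_neq0; apply/is_zeroE.
by rewrite -(proj1 dual) coev0 tens0m compm0 comp0m.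
Qed.

(** The map u |-> (X (x) u) o coev is the adjunction bijection
    Hom(D, W) = Hom(1, X (x) W); its injectivity is the zigzag identity on D. *)
Lemma duality_transpose_inj0 W (u : mor D W) :
  (idm X \om u) \oc coev = 0 -> u = 0.
Proof.
move=> u0; rewrite -(compm1 u) -(proj2 dual) !compmA -lunit_nat.
rewrite -(compmA _ (idm _ \om u)) -whiskC !compmA.
rewrite -(compmA _ _ (bwd (assoc _ _ _))) -tensm1 -assoc_bwd_nat !compmA.
by rewrite -(compmA _ _ (idm D \om coev)) lwhiskM u0 tensm0 compm0 comp0m.
Qed.

(** The zigzag identity with its unit isomorphisms moved to the other side: the
    snake is an isomorphism, which is all that a double transpose requires. *)
Lemma duality_snake :
  (ev \om idm D) \oc (bwd (assoc D X D) \oc (idm D \om coev)) =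
  bwd (lunit D) \oc fwd (runit D).
Proof.
rewrite -[LHS]comp1m -(fwdK (lunit D)) -compmA; congr (_ \oc _).
by rewrite -[LHS]compm1 -(fwdK (runit D)) !compmA (proj2 dual) comp1m.
Qed.

(** The functor - (x) D has the left adjoint - (x) X, so it preserves
    monomorphisms. *)
Lemma rwhisk_dual_mono Y Y' (f : mor Y Y') :
  is_mono f -> is_mono (f \om idm D).
Proof.
move=> f_mono; apply: mono_of_cancel0 => Z v fv0.
(* v' is the transpose of v, up to the unit isomorphism of Y. *)
pose v' := (idm Y \om ev) \oc fwd (assoc Y D X) \oc (v \om idm X).
have v'0 : v' = 0.
  have v'f0 : (f \om idm (unit1 A)) \oc v' = 0.
    rewrite /v' !compmA whiskC -(compmA _ (f \om _)) -tensm1 -assoc_nat.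
    by rewrite compmA -(compmA _ _ (v \om _)) rwhiskM fv0 tens0m compm0.
  rewrite -(comp1m v') -(fwdK (runit Y)) -compmA.
  rewrite (mono_cancel0 (u := fwd (runit Y) \oc v') f_mono) ?compm0 //.
  by rewrite compmA -runit_nat -compmA v'f0 compm0.
apply: rwhisk_unit_inj0.
(* Transposing v' back gives v (x) 1 followed by an associator, the snake
   whiskered by Y and an inverse associator, all three of them invertible. *)
have : (v' \om idm D) \oc bwd (assoc Z X D) \oc (idm Z \om coev) = 0.
  by rewrite v'0 tens0m !comp0m.
rewrite /v' -!rwhiskM -!compmA (compmA _ (bwd _)) -assoc_bwd_nat tensm1.
rewrite -!compmA whiskC !compmA -(compmA _ _ (bwd _)) pentagon_bwd !compmA.
rewrite -assoc_bwd_nat -!compmA (compmA (fwd _) (idm _ \om _)).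
rewrite -{1}(tensm1 Y D) assoc_nat !compmA => H.
(* Cancel the associator and the snake on the left. *)
have := congr1 (fun h => (idm Y \om (bwd (runit D) \oc fwd (lunit D)))
  \oc fwd (assoc _ _ _) \oc h) H.
rewrite !compmA compm0 -(compmA _ (fwd _) (bwd _)) bwdK compm1 !lwhiskM.
rewrite -!compmA duality_snake (compmA (fwd (lunit D))) bwdK comp1m fwdK.
rewrite tensm1 comp1m => {}H.
by rewrite -[LHS]comp1m -(fwdK (assoc _ _ _)) -compmA H compm0.
Qed.

(** The functor D (x) - has the right adjoint X (x) -, so it preserves
    epimorphisms. *)
Lemma lwhisk_dual_epi Y Y' (f : mor Y Y') :
  is_epi f -> is_epi (idm D \om f).
Proof.
move=> f_epi; apply: epi_of_cancel0 => W u fu0.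
(* u' is the transpose of u, up to the unit isomorphism of Y'. *)
pose u' := (idm X \om u) \oc fwd (assoc X D Y') \oc (coev \om idm Y').
have u'0 : u' = 0.
  have u'f0 : u' \oc (idm (unit1 A) \om f) = 0.
    rewrite /u' -!compmA whiskC (compmA (fwd _)) -tensm1 assoc_nat.
    by rewrite !compmA lwhiskM fu0 tensm0 !comp0m.
  rewrite -(compm1 u') -(fwdK (lunit Y')) compmA.
  rewrite (epi_cancel0 (u := u' \oc bwd (lunit Y')) f_epi) ?comp0m //.
  rewrite -compmA.
  have -> : bwd (lunit Y') \oc f = (idm (unit1 A) \om f) \oc bwd (lunit Y).
    rewrite -[RHS]comp1m -(fwdK (lunit Y')) -compmA (compmA (fwd _)).
    by rewrite lunit_nat -!compmA bwdK compm1.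
  by rewrite compmA u'f0 comp0m.
apply: lwhisk_unit_inj0.
(* Transposing u' back gives 1 (x) u preceded by an associator, the snake
   whiskered by Y' and an inverse associator. *)
have : (ev \om idm W) \oc bwd (assoc D X W) \oc (idm D \om u') = 0.
  by rewrite u'0 tensm0 !compm0.
rewrite /u' -!lwhiskM !compmA.
rewrite -(compmA _ (bwd _) (idm D \om (_ \om u))) assoc_bwd_nat tensm1.
rewrite !compmA whiskC -!compmA (compmA (bwd _) (idm D \om fwd _)).
rewrite pentagon_bwd_r -!compmA assoc_bwd_nat (compmA (_ \om _) (fwd _)).
rewrite -(tensm1 D Y') -assoc_nat -!compmA.
rewrite !(compmA (_ \om idm Y') (_ \om idm Y')) !rwhiskM.
rewrite !(compmA (_ \om idm Y') (_ \om idm Y')) !rwhiskM -!compmA.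
rewrite duality_snake => H.
(* Cancel the inverse associator and the snake on the right. *)
have := congr1 (fun h => h \oc fwd (assoc _ _ _)
  \oc ((bwd (runit D) \oc fwd (lunit D)) \om idm Y')) H.
rewrite !comp0m -!compmA (compmA (bwd (assoc _ _ _))) fwdK comp1m rwhiskM.
rewrite -!compmA (compmA (fwd (runit D))) bwdK comp1m fwdK tensm1 compm1 => {}H.
by rewrite -[LHS]compm1 -(bwdK (assoc _ _ _)) compmA H comp0m.
Qed.

End Duality.
End Mon.

(** * Simplicity of the unit object *)

Section Unit.
Variables (k : fieldType) (A : monCat k).
Hypothesis mtA : is_multitensor A.
Hypothesis EndA :
  bijective (fun a : k => a *: idm (unit1 A) : mor (unit1 A) (unit1 A)).

(** The transpose t : 1 -> D of a subobject i of 1 is epi: if u o t = 0, then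
    the transpose 1 -> J (x) W of u is killed by the monomorphism i (x) W, as
    sliding u past i turns the composite into u o t. *)
Lemma dual_inclusion_epi (D J : A) (i : mor J (unit1 A))
    (ev : mor (D \ox J) (unit1 A)) (coev : mor (unit1 A) (J \ox D)) :
  is_duality ev coev -> is_mono i ->
  is_epi (fwd (lunit D) \oc (i \om idm D) \oc coev).
Proof.
move=> dual i_mono; apply: epi_of_cancel0 => W u u0.
apply: (duality_transpose_inj0 (multitensor_bilinear mtA) dual).
have [_ [W' [ev' [coev' dual']]]] := multitensor_rigid mtA W.
apply: (mono_cancel0 (f := i \om idm W)).
  exact: (rwhisk_dual_mono (multitensor_bilinear mtA) dual').
apply: (mono_cancel0 (f := fwd (lunit W))); first exact: split_mono (fwdK _).
by rewrite (compmA (i \om _)) whiskC !compmA lunit_nat -u0 !compmA.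
Qed.

Lemma unit_neq0 : ~ is_zero (unit1 A).
Proof.
move=> /is_zeroE id0; have [g gK _] := EndA.
have /eqP := can_inj gK (etrans (scale1r _) (etrans id0 (esym (scale0r _)))).
by rewrite oner_eq0.
Qed.

(** Tensoring t : 1 -> D with J gives an epimorphism q from J onto J (x) D,
    which is injective because J is simple; the preimage of coev under q is
    a map s : 1 -> J, and it splits i up to a scalar. *)
Lemma simple_sub_unit_iso (J : A) (i : mor J (unit1 A)) :
  is_simple J -> is_mono i -> is_iso i.
Proof.
move=> J_simple i_mono.
have abA := multitensor_abelian mtA; have bilA := multitensor_bilinear mtA.
have [[D [ev [coev dual]]] [D' [ev' [coev' dual']]]] :=
  multitensor_rigid mtA J.
have coev_n0 := coev_neq0 bilA dual (proj1 J_simple).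
pose q := (idm J \om (fwd (lunit D) \oc (i \om idm D) \oc coev))
  \oc bwd (runit J).
have q_epi : is_epi q.
  apply: epi_comp; last exact: split_epi (fwdK _).
  exact: (lwhisk_dual_epi bilA dual' (dual_inclusion_epi dual i_mono)).
(* If q = 0, being epi it forces J (x) D = 0, against coev <> 0. *)
have q_mono : is_mono q.
  apply: (simple_mono abA J_simple) => q0; apply: coev_n0.
  rewrite -[LHS]comp1m (epi_cancel0 (u := idm _) q_epi) ?comp0m //.
  by rewrite comp1m.
(* A monomorphism is the kernel of some g; as q is also epi, g = 0, so that
   every morphism into J (x) D lifts through q. *)
have [Z [g [gq0 ker_g]]] := abelian_mono abA q_mono.
have [s [qs _]] : exists! s, q \oc s = coev.
  by apply: ker_g; rewrite (epi_cancel0 q_epi gq0) comp0m.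
have [c _ cK] := EndA; pose a := c (i \oc s).
have is_a : i \oc s = a *: idm _ by rewrite [RHS]cK.
have a_n0 : a != 0.
  apply/eqP => a0; apply: coev_n0; rewrite -qs.
  by rewrite (mono_cancel0 (u := s) i_mono) ?compm0 // is_a a0 scale0r.
have ir : i \oc (a^-1 *: s) = idm _ by rewrite compmZ is_a scalerA mulVf ?scale1r.
exists (a^-1 *: s); split=> //.
by apply: i_mono; rewrite compmA ir comp1m compm1.
Qed.

Lemma unit_simple : is_simple (unit1 A).
Proof.
split; first exact: unit_neq0.
have [J [i [J_simple i_mono]]] := finite_length_simple_sub
  (proj2 (multitensor_locally_finite mtA) _) unit_neq0.
have [r [ri ir]] := simple_sub_unit_iso J_simple i_mono.
move=> Y f f_mono.
have rf_mono : is_mono (r \oc f) by apply: mono_comp (split_mono ir) f_mono.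
case: (proj2 J_simple _ _ rf_mono) => [|[g [grf rfg]]]; first by left.
right; exists (g \oc r); split; first by rewrite -compmA.
by rewrite -[LHS]comp1m -ir -compmA !(compmA r) (compmA (r \oc f)) rfg comp1m.
Qed.

End Unit.

Theorem proposition4p11 (k : closedFieldType) (A : monCat k) (C : A -> Prop) :
  is_tensor_category A -> is_serre_tensor_ideal C ->
  (forall X : A, C X -> is_zero X) \/ (forall X : A, C X).
Proof.
move=> [mtA EndA _] [serreC idealC].
case: (classic (forall X : A, C X -> is_zero X)) => [|C_n0]; first by left.
right.
have [X CXn0] := not_all_ex_not _ _ C_n0.
have [CX X_n0] := imply_to_and _ _ CXn0.
have [[D [ev [coev dual]]] _] := multitensor_rigid mtA X.
have coev_mono : is_mono coev.
  apply: (simple_mono (multitensor_abelian mtA) (unit_simple mtA EndA)).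
  exact: (coev_neq0 (multitensor_bilinear mtA) dual X_n0).
have C1 : C (unit1 A).
  exact: (serre_sub serreC coev_mono (proj2 (idealC D X CX))).
move=> Y; apply: (serre_quot serreC (split_epi (bwdK (runit Y)))).
exact: (proj1 (idealC Y _ C1)).
Qed.
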